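(* Let $\lambda\in\mathbb{R}$ and $r\in\mathbb{N}\cup\{0\}$. For every integer $n\ge0$, the following identity holds (as polynomials in the variable $x$): $$Bel_{n,\lambda}^{(r)}(x)=\sum_{k=0}^{n}\sum_{m=0}^{k}\binom{n}{k}\,Bel_{n-k,\lambda}(x)\,\lambda^{k-m}\,r^m\,S_1(k,m).$$
   Context: All generating functions are formal power series in $t$. For a number $y$, $(1+\lambda t)^{y/\lambda}$ denotes the formal power series $\sum_{n\ge0}(y|\lambda)_n\frac{t^n}{n!}$, where $(y|\lambda)_0=1$ and $(y|\lambda)_n=y(y-\lambda)(y-2\lambda)\cdots(y-(n-1)\lambda)$ for $n\ge1$ (for $\lambda=0$ this is the limit $e^{yt}$). The convention $0^0=1$ is used. The (signed) Stirling numbers of the first kind $S_1(n,k)$ are defined by $(x)_n=\sum_{k=0}^n S_1(n,k)x^k$, where $(x)_0=1$ and $(x)_n=x(x-1)\cdots(x-n+1)$ for $n\ge1$. The degenerate Bell polynomials $Bel_{n,\lambda}(x)$ are defined by $$e^{x\left((1+\lambda t)^{1/\lambda}-1\right)}=\sum_{n=0}^\infty Bel_{n,\lambda}(x)\frac{t^n}{n!}.$$ The extended degenerate Bell polynomials $Bel_{n,\lambda}^{(r)}(x)$ are defined by $$(1+\lambda t)^{r/\lambda}\,e^{x\left((1+\lambda t)^{1/\lambda}-1\right)}=\sum_{n=0}^\infty Bel_{n,\lambda}^{(r)}(x)\frac{t^n}{n!}.$$ *)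

(* Defs.v *)
From HB Require Import structures.
From mathcomp Require Import all_boot all_order all_algebra.

Set Implicit Arguments.
Unset Strict Implicit.
Unset Printing Implicit Defensive.

Import Order.TTheory GRing.Theory Num.Theory.
Local Open Scope ring_scope.

(* A formal power series in t over the ring R[x] is its sequence of
   coefficients: f stands for \sum_n (f n) t^n. *)
Definition fps (R : numFieldType) := nat -> {poly R}.

Section DegenerateBell.
Variable R : numFieldType.

Definition fps_one : fps R := fun n => (n == 0%N)%:R.

(* Cauchy product. *)
Definition fps_mul (f g : fps R) : fps R :=
  fun n => \sum_(i < n.+1) f i * g (n - i)%N.

Definition fps_pow (f : fps R) (k : nat) : fps R := iter k (fps_mul f) fps_one.

(* e^f = \sum_k f^k / k!, only meaningful when f 0 = 0; f^k then has no term
   of degree < k, so that the coefficient of t^n only involves k <= n. *)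
Definition fps_exp (f : fps R) : fps R :=
  fun n => \sum_(k < n.+1) (k`!%:R)^-1 *: fps_pow f k n.

(* (y | lambda)_n *)
Definition dffact (lambda y : R) (n : nat) : R :=
  \prod_(i < n) (y - i%:R * lambda).

(* (1 + lambda t)^(y / lambda); for lambda = 0 this is e^(y t). *)
Definition dexp (lambda y : R) : fps R :=
  fun n => (dffact lambda y n / n`!%:R)%:P.

(* e^(x ((1 + lambda t)^(1 / lambda) - 1)) *)
Definition bell_gf (lambda : R) : fps R :=
  fps_exp (fun n => 'X * (dexp lambda 1 n - fps_one n)).

(* If f = \sum_n (a n) t^n / n!, then a n = n! (f n). *)
Definition egf_coef (f : fps R) (n : nat) : {poly R} := n`!%:R *: f n.

Definition dbell (lambda : R) (n : nat) : {poly R} :=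
  egf_coef (bell_gf lambda) n.

Definition dbell_ext (lambda : R) (r n : nat) : {poly R} :=
  egf_coef (fps_mul (dexp lambda r%:R) (bell_gf lambda)) n.

End DegenerateBell.

Definition ffact_poly (n : nat) : {poly int} := \prod_(i < n) ('X - (i%:R)%:P).

Definition stirling1 (n k : nat) : int := (ffact_poly n)`_k.

(* Main.v *)
(** The claim is the Cauchy product of the two factors of the generating
    function once [(r | lambda)_k] is expanded in powers of [r]: it is the
    homogenization of the falling factorial [(r)_k], with coefficients
    [lambda^(k-m) S_1(k,m)], which also covers [lambda = 0]. *)

Require Import Defs.
From mathcomp Require Import all_boot all_order all_algebra reals ring.
Import GRing.Theory Num.Theory.
Local Open Scope ring_scope.

Lemma size_ffact_poly (n : nat) : size (ffact_poly n) = n.+1.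
Proof. by rewrite /ffact_poly size_prod_XsubC /index_enum -enumT size_enum_ord. Qed.

Lemma ffact_polyS (n : nat) :
  ffact_poly n.+1 = ffact_poly n * ('X - (n%:R)%:P).
Proof. by rewrite /ffact_poly big_ord_recr. Qed.

Lemma stirling1_small (n k : nat) : (n < k)%N -> stirling1 n k = 0.
Proof. by move=> lt_nk; apply: nth_default; rewrite size_ffact_poly. Qed.

Lemma stirling1S0 (n : nat) : stirling1 n.+1 0 = - (stirling1 n 0 * n%:R).
Proof. by rewrite /stirling1 ffact_polyS mulrBr coefB coefMX coefMC sub0r. Qed.

Lemma stirling1SS (n k : nat) :
  stirling1 n.+1 k.+1 = stirling1 n k - stirling1 n k.+1 * n%:R.
Proof. by rewrite /stirling1 ffact_polyS mulrBr coefB coefMX coefMC. Qed.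

(** Induction with the recurrence of [stirling1] avoids dividing by [lambda], as substituting
    [y / lambda] into the falling factorial would. *)
Lemma dffact_stirling1 (R : numFieldType) (lambda y : R) (n : nat) :
  dffact lambda y n =
  \sum_(m < n.+1) lambda ^+ (n - m) * y ^+ m * (stirling1 n m)%:~R.
Proof.
elim: n => [|n IHn].
  rewrite /dffact big_ord0 big_ord1 /stirling1 /ffact_poly big_ord0 coef1.
  by rewrite !expr0 !mulr1.
rewrite /dffact big_ord_recr /= -/(dffact lambda y n) mulrBr.
rewrite big_ord_recl stirling1S0 /= subn0.
under eq_bigr => i _.
  rewrite /bump /= add1n subSS stirling1SS rmorphB mulrBr.
  over.
(* The terms in [stirling1 n i] form the product with [y]; the rest, head included, form the product
   with [- n * lambda]. *)
rewrite big_split /= addrCA; congr (_ + _).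
  rewrite IHn mulr_suml; apply: eq_bigr => i _.
  by rewrite exprSr mulrA mulrAC.
(* A vanishing term [m = n.+1] is added so that both sums have the same range. *)
have -> : dffact lambda y n =
    \sum_(m < n.+2) lambda ^+ (n - m) * y ^+ m * (stirling1 n m)%:~R.
  by rewrite big_ord_recr /= stirling1_small // mulr0 addr0.
rewrite mulr_suml big_ord_recl opprD -sumrN; congr (_ + _).
  by rewrite subn0 rmorphN rmorphM /= exprSr; ring.
apply: eq_bigr => i _; rewrite /= rmorphM /=.
(* At [i = n] the truncated [n - i.+1] breaks the match of powers of [lambda], but
   [stirling1 n n.+1] is zero. *)
have [lt_in|le_ni] := ltnP i n; last by rewrite stirling1_small //; ring.
by rewrite -(subnSK lt_in) exprSr; ring.
Qed.

Theorem theorem2p5 (R : realType) (lambda : R) (r n : nat) :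
  dbell_ext lambda r n =
  \sum_(k < n.+1) \sum_(m < k.+1)
    ('C(n, k)%:R * lambda ^+ (k - m) * r%:R ^+ m * (stirling1 k m)%:~R)
      *: dbell lambda (n - k).
Proof.
(* For each [k], both sides are multiples of the same coefficient of [bell_gf lambda]; only scalars
   remain to compare. *)
rewrite /dbell_ext /egf_coef /fps_mul scaler_sumr; apply: eq_bigr => k _.
rewrite -scaler_suml /dbell /egf_coef /dexp mul_polyC !scalerA.
congr (_ *: _).
under [in RHS]eq_bigr do rewrite -!mulrA.
rewrite -mulr_sumr.
under [in RHS]eq_bigr do rewrite mulrA.
have le_kn : (k <= n)%N by rewrite -ltnS.
(* The binomial comes from the factorial normalizations: [n! = C(n,k) k! (n-k)!]. *)
rewrite -dffact_stirling1 -(bin_fact le_kn) !natrM.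
have k_neq0 : k`!%:R != 0 :> R by rewrite pnatr_eq0 -lt0n fact_gt0.
by field.
Qed.
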